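(* Let $\mathbb K$ be a field of characteristic $0$, let $g,f\in\mathbb K[[t]]$ with $g(0)\neq0$, $f(0)=0$, $[t]f\ne0$, and let $R=[r_{n,k}]_{n,k\ge0}=(g(t),f(t))$ be the corresponding Riordan matrix. Consider the associated Riordan type matrices $R^\sharp=[r^\sharp_{n,k}]_{n,k\ge0}=(g(t),f(t)+1)$ and $R^\natural=[r^\natural_{n,k}]_{n,k\ge0}=(g(t),f(t)-1)$. Then for all $m,n,s\in\mathbb N$ with $s\ge n$, $$\sum_{k=0}^n\binom nk r_{s,n-k}\,k^m=\sum_{k=0}^m{m\brace k}\binom nk k!\,r^\sharp_{s,n-k},$$ $$\sum_{k=0}^n\binom nk(-1)^{n-k}r_{s,n-k}\,k^m=\sum_{k=0}^m{m\brace k}\binom nk(-1)^{n-k}k!\,r^\natural_{s,n-k}.$$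
   Context: $\mathbb N=\{0,1,2,\ldots\}$. For formal power series $g,F\in\mathbb K[[t]]$, the matrix $(g,F)$ has $(n,k)$ entry $[t^n]\,gF^k$ for $n,k\ge0$. ${m\brace k}$ denotes the Stirling number of the second kind. Conventions: $0^0=1$; $\binom nk=0$ for $k>n$, and the corresponding terms in the right-hand sums are $0$. *)

(* Defs.v *)
From mathcomp Require Import all_boot all_order all_algebra.

Set Implicit Arguments.
Unset Strict Implicit.
Unset Printing Implicit Defensive.

Import GRing.Theory.
Local Open Scope ring_scope.

(* K[[t]] as coefficient sequences: [F n] is the coefficient [t^n] F. *)
Definition fps (K : fieldType) : Type := nat -> K.

Definition fps_one (K : fieldType) : fps K := fun n => (n == 0%N)%:R.

Definition fps_add (K : fieldType) (F G : fps K) : fps K :=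
  fun n => F n + G n.

Definition fps_sub (K : fieldType) (F G : fps K) : fps K :=
  fun n => F n - G n.

Definition fps_mul (K : fieldType) (F G : fps K) : fps K :=
  fun n => \sum_(i < n.+1) F i * G (n - i)%N.

Definition fps_exp (K : fieldType) (F : fps K) (k : nat) : fps K :=
  iter k (fps_mul F) (fps_one K).

(* The matrix (g, F).  Nothing is assumed on F(0), so that this also covers the
   Riordan type matrices (g, f + 1) and (g, f - 1), which are not lower
   triangular. *)
Definition riordan_mx (K : fieldType) (g F : fps K) (n k : nat) : K :=
  fps_mul g (fps_exp F k) n.

(* Stirling number of the second kind: the number of partitions of an m-element
   set into k (nonempty) blocks. *)
Definition stirling2 (m k : nat) : nat :=
  #|[set P : {set {set 'I_m}} | partition P [set: 'I_m] & #|P| == k]|.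

(* Main.v *)
(** Since [R^sharp] and [R^natural] are [(g, f + c)] with [c = 1] and [c = -1],
    both identities are instances of one identity in [c], where [c ^+ 2 = 1].
    Expand [k ^ m] as the sum over [j] of [stirling2 m j * k ^_ j] (count maps
    ['I_m -> 'I_k] by the partition into fibers), absorb the falling factorial by
    ['C(n, k) * k ^_ j = 'C(n, j) * j`! * 'C(n - j, k - j)], and recognize the
    inner sum as the binomial expansion of [g (f + c)^(n - j)]. *)

Require Import Defs.
From mathcomp Require Import all_boot all_order all_algebra ring.

Import GRing.Theory.
Local Open Scope ring_scope.

Lemma card_partition_leq (T : finType) (P : {set {set T}}) (D : {set T}) :
  partition P D -> (#|P| <= #|D|)%N.
Proof.
move=> partP; have /and3P[_ _ P0] := partP.
rewrite (card_partition partP) -sum1_card leq_sum // => A AP.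
by rewrite card_gt0; apply: contraNneq P0 => <-.
Qed.

(** A map whose fibers are unions of blocks of [P] factors through the block map [b], and its fibers
    are exactly the blocks when the induced map on blocks is injective. So [lift] matches the maps
    counted here with the injections from the blocks to [rT]. *)
Lemma card_ffun_preim_partition (T rT : finType) (P : {set {set T}}) :
  partition P [set: T] ->
  #|[set f : {ffun T -> rT} | preim_partition f [set: T] == P]| = #|rT| ^_ #|P|.
Proof.
move=> partP; have /and3P[/eqP covP tiP P0] := partP.
have pbP x : pblock P x \in P by rewrite pblock_mem // covP.
have mem_pb x : x \in pblock P x by rewrite mem_pblock covP.
pose S := {B : {set T} | B \in P}.
pose b x : S := exist _ (pblock P x) (pbP x).
have b_surj (B : S) : exists x, b x == B.
  case: B => B PB; have /set0Pn[x xB] : B != set0.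
    by apply: contraNneq P0 => <-.
  by exists x; rewrite -val_eqE /= (def_pblock tiP PB xB).
have bE x y : (b x == b y) = (y \in pblock P x).
  by rewrite -val_eqE /= eq_pblock // covP.
pose lift (h : {ffun S -> rT}) := [ffun x => h (b x)].
have lift_inj : injective lift.
  move=> h1 h2 /ffunP eq_h; apply/ffunP => B; have [x /eqP <-] := b_surj B.
  by have := eq_h x; rewrite !ffunE.
have <- : #|{: S}| = #|P| by rewrite card_sig; apply: eq_card.
rewrite -card_inj_ffuns -(card_imset _ lift_inj).
apply: eq_card => f; rewrite inE; apply/eqP/imsetP => [fP | [h]].
- have eq_f x y : (y \in pblock P x) = (f x == f y).
    by rewrite -fP pblock_equivalence_partition ?inE //; split=> // /eqP->.
  pose h := [ffun B : S => f (xchoose (b_surj B))].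
  have hb x : h (b x) = f x.
    by apply/eqP; rewrite ffunE -eq_f -bE (xchooseP (b_surj (b x))).
  exists h; last by apply/ffunP => x; rewrite ffunE hb.
  rewrite inE; apply/injectiveP => B C; have [x /eqP <-] := b_surj B.
  have [y /eqP <-] := b_surj C; rewrite !hb => /eqP.
  by rewrite -eq_f -bE => /eqP.
- rewrite inE => /injectiveP inj_h ->.
  rewrite -[RHS](equivalence_partition_pblock partP).
  apply: eq_imset => x; apply/setP => y.
  by rewrite !inE /= !ffunE (inj_eq inj_h) bE.
Qed.

Lemma expn_stirling2 (k m : nat) :
  (k ^ m = \sum_(j < m.+1) stirling2 m j * k ^_ j)%N.
Proof.
pose kerp (f : {ffun 'I_m -> 'I_k}) := preim_partition f [set: 'I_m].
pose parts := [pred P : {set {set 'I_m}} | partition P [set: 'I_m]].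
transitivity (\sum_(P | parts P) k ^_ #|P|)%N.
  rewrite -[in LHS](card_ord m) -[in LHS](card_ord k) -card_ffun -sum1_card.
  rewrite (partition_big kerp parts) => [|f _]; last exact: preim_partitionP.
  apply: eq_bigr => P partP; rewrite -[in RHS](card_ord k).
  by rewrite -card_ffun_preim_partition // -sum1dep_card.
(* [inord] loses nothing here, since a partition of an [m]-element set has at most [m] blocks. *)
rewrite (partition_big (fun P : {set _} => inord #|P| : 'I_m.+1) xpredT) //.
apply: eq_bigr => j _; rewrite /stirling2 -sum1dep_card big_distrl /=.
have in_inord P : parts P -> (inord #|P| == j) = (#|P| == j).
  move=> partP; rewrite -val_eqE /= inordK // ltnS -[leqRHS](card_ord m).
  by rewrite -cardsT card_partition_leq.
apply: eq_big => [P | P /andP[partP]].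
  by apply: andb_id2l => /in_inord.
by rewrite in_inord // mul1n => /eqP->.
Qed.

(** Multiplied by [(k - j)! (n - k)!], both sides become [n!]. *)
Lemma mul_bin_ffact (n k j : nat) : (j <= k <= n)%N ->
  ('C(n, k) * k ^_ j = 'C(n, j) * j`! * 'C(n - j, k - j))%N.
Proof.
move=> /andP[jk kn]; have jn := leq_trans jk kn.
apply/eqP; rewrite -(eqn_pmul2r (fact_gt0 (k - j))).
rewrite -(eqn_pmul2r (fact_gt0 (n - k))) -!mulnA.
rewrite (mulnA (k ^_ j)) ffact_fact // bin_fact //.
have -> : (n - k = (n - j) - (k - j))%N by rewrite subnBA // subnK.
by rewrite bin_fact ?leq_sub2r // bin_fact.
Qed.

Section Riordan.

Variable K : fieldType.
Implicit Types (g f F : fps K) (p q : {poly K}) (c : K).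

(** Coefficients of a product up to order [s] depend only on those of the factors up to [s].
    Polynomials can thus stand in for power series, which makes the ring laws of [{poly K}]
    available. *)
Lemma coef_fps_mul F g p q s :
  (forall i, (i <= s)%N -> F i = p`_i) -> (forall i, (i <= s)%N -> g i = q`_i) ->
  forall i, (i <= s)%N -> fps_mul F g i = (p * q)`_i.
Proof.
move=> Fp gq i le_is; rewrite coefM; apply: eq_bigr => j _.
rewrite Fp ?gq //; first exact: leq_trans (leq_subr _ _) le_is.
by apply: leq_trans le_is; rewrite -ltnS.
Qed.

Lemma coef_riordan_mx g F p q s k :
  (forall i, (i <= s)%N -> g i = p`_i) -> (forall i, (i <= s)%N -> F i = q`_i) ->
  riordan_mx g F s k = (p * q ^+ k)`_s.
Proof.
move=> gp Fq; apply: (coef_fps_mul _ _ _ _ s) => //.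
elim: k => [|k IHk] i le_is; first by rewrite coef1.
by rewrite exprS; apply: coef_fps_mul le_is.
Qed.

(** This is the binomial theorem for [(c + f)^k], applied to the truncations at order [s]. *)
Lemma riordan_mx_shift g f F c s k : (forall i, F i = f i + c * fps_one K i) ->
  riordan_mx g F s k =
  \sum_(i < k.+1) 'C(k, i)%:R * c ^+ (k - i) * riordan_mx g f s i.
Proof.
move=> FE; pose P (h : fps K) := \poly_(i < s.+1) h i.
have PE h i : (i <= s)%N -> h i = (P h)`_i.
  by move=> le_is; rewrite coef_poly ltnS le_is.
have FP i : (i <= s)%N -> F i = (c%:P + P f)`_i.
  move=> le_is; rewrite coefD -PE // coefC FE addrC /fps_one.
  by case: eqP; rewrite ?mulr1 ?mulr0.
rewrite (coef_riordan_mx _ _ _ _ _ _ (PE g) FP) exprDn mulr_sumr coef_sum.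
apply: eq_bigr => i _; rewrite (coef_riordan_mx _ _ _ _ _ _ (PE g) (PE f)).
rewrite -polyC_exp mulrnAr coefMn mulrCA coefCM.
by rewrite -[LHS]mulr_natl mulrA.
Qed.

Lemma sum_binomial_expn_riordan_mx g f F c m n s :
    c * c = 1 -> (forall i, F i = f i + c * fps_one K i) ->
  \sum_(k < n.+1)
    'C(n, k)%:R * c ^+ (n - k) * riordan_mx g f s (n - k)%N * k%:R ^+ m =
  \sum_(j < m.+1) (stirling2 m j)%:R * 'C(n, j)%:R * c ^+ (n - j) * (j`!)%:R
    * riordan_mx g F s (n - j)%N.
Proof.
move=> cc FE.
under eq_bigr do rewrite -natrX expn_stirling2 natr_sum mulr_sumr.
rewrite exchange_big; apply: eq_bigr => j _ /=.
(* For [n < j] both sides vanish: ['C(n, j) = 0], and [k ^_ j = 0] for every [k <= n]. *)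
have [lt_nj | le_jn] := ltnP n j.
  rewrite bin_small // mulr0 !mul0r big1 // => k _.
  by rewrite ffact_small ?muln0 ?mulr0 // (leq_trans (ltn_ord k)).
rewrite (riordan_mx_shift _ _ _ _ _ _ FE) mulr_sumr.
(* Reversing the left sum makes [i] the column of [riordan_mx g f] on both sides. The right sum,
   over [i <= n - j], is then extended to [i <= n]; the extra terms on the left are zero because
   [n - i < j]. *)
rewrite (reindex_inj rev_ord_inj) /=.
rewrite (big_ord_widen n.+1 (fun i =>
  _ * ('C(n - j, i)%:R * c ^+ (n - j - i) * riordan_mx g f s i)))
  ?ltnS ?leq_subr //.
rewrite [RHS]big_mkcond /=.
apply: eq_bigr => i _; have le_in : (i <= n)%N by rewrite -ltnS.
have le_ij : (i <= n - j)%N = (j <= n - i)%N by rewrite !leq_subRL // addnC.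
rewrite subSS subKn // ltnS le_ij; case: ifP => [le_jni | /negbT]; last first.
  by rewrite -ltnNge => lt_nij; rewrite ffact_small // muln0 mulr0.
have le_inj : (i <= n - j)%N by rewrite le_ij.
(* Here [c * c = 1] enters: the exponents on the two sides differ by the even number
   [2 (n - j - i)]. *)
have c_sym : c ^+ (n - j) * c ^+ (n - j - i) = c ^+ i.
  by rewrite -{1}(subnKC le_inj) exprD -mulrA -exprMn cc expr1n mulr1.
have := congr1 (fun x : nat => x%:R : K) (mul_bin_ffact n (n - i) j _).
rewrite le_jni leq_subr => /(_ isT).
rewrite -subnDA addnC subnDA !bin_sub // !natrM => binE.
rewrite -c_sym.
transitivity ((stirling2 m j)%:R * ('C(n, i)%:R * ((n - i) ^_ j)%:R)
  * (c ^+ (n - j) * c ^+ (n - j - i)) * riordan_mx g f s i); first by ring.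
by rewrite binE; ring.
Qed.

End Riordan.

Theorem theorem5p2 (K : fieldType) (charK0 : [pchar K] =i pred0)
    (g f : fps K) (g0 : g 0%N != 0) (f0 : f 0%N = 0) (f1 : f 1%N != 0) :
  let r := riordan_mx g f in
  let r_sharp := riordan_mx g (fps_add f (fps_one K)) in
  let r_natural := riordan_mx g (fps_sub f (fps_one K)) in
  forall m n s : nat, (n <= s)%N ->
    \sum_(k < n.+1) 'C(n, k)%:R * r s (n - k)%N * k%:R ^+ m =
    \sum_(k < m.+1)
      (stirling2 m k)%:R * 'C(n, k)%:R * (k`!)%:R * r_sharp s (n - k)%N
    /\
    \sum_(k < n.+1)
      'C(n, k)%:R * (-1) ^+ (n - k)%N * r s (n - k)%N * k%:R ^+ m =
    \sum_(k < m.+1)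
      (stirling2 m k)%:R * 'C(n, k)%:R * (-1) ^+ (n - k)%N * (k`!)%:R
        * r_natural s (n - k)%N.
Proof.
move=> r r_sharp r_natural m n s _; split.
  pose f_sharp := fps_add f (fps_one K).
  have f_sharpE i : f_sharp i = f i + 1 * fps_one K i by rewrite mul1r.
  have sumE := sum_binomial_expn_riordan_mx K g f _ 1 m n s (mulr1 1) f_sharpE.
  (* For [c = 1] the powers of [c] are erased from both sums. *)
  by apply: etrans (etrans _ sumE) _; apply: eq_bigr => k _; rewrite expr1n mulr1.
apply: sum_binomial_expn_riordan_mx; first by rewrite mulrNN mulr1.
by move=> i; rewrite mulN1r.
Qed.
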